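(* Let $n$ be a positive integer, let $\omega=\exp\left(\frac{2\pi i}{n}\right)$ and $\mu=\exp\left(\frac{\pi i}{n}\right)$. Then for every integer $m\ge 0$ and every $s\in\{1,\dots,n\}$, $$\sum_{t\ge 0}\binom{m}{nt+s-1}=\frac{1}{n}\sum_{j=1}^{n}(\omega^{j}+1)^{m}\,\omega^{j(1-s)}$$ and $$\sum_{t\ge 0}(-1)^{t}\binom{m}{nt+s-1}=\frac{1}{n}\sum_{j=1}^{n}(\mu^{2j-1}+1)^{m}\,\mu^{(2j-1)(1-s)}.$$
   Context: In $\exp\left(\frac{2\pi i}{n}\right)$ and $\exp\left(\frac{\pi i}{n}\right)$, $i$ is the imaginary unit. The sums over $t\ge 0$ run over nonnegative integers $t$; $\binom{m}{k}=0$ for $k>m$, so these sums are finite. The convention $0^0=1$ is used (relevant when $m=0$ and a summand base $\omega^j+1$ or $\mu^{2j-1}+1$ vanishes). *)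

(* Defs.v *)
From mathcomp Require Import all_boot all_order all_algebra.
From mathcomp Require Import complex.
From mathcomp Require Import classical_sets fsbigop reals sequences exp trigo.

Set Implicit Arguments.
Unset Strict Implicit.
Unset Printing Implicit Defensive.

Local Open Scope ring_scope.
Local Open Scope complex_scope.

(* The complex exponential: exp (x + i y) = exp x * (cos y + i * sin y). *)
Definition cexp (R : realType) (z : R[i]) : R[i] :=
  (expR (complex.Re z))%:C * (cos (complex.Im z) +i* sin (complex.Im z)).

(* Main.v *)
Require Import Defs.
From mathcomp Require Import all_boot all_order all_algebra.
From mathcomp Require Import ring.
From mathcomp Require Import complex.
From mathcomp Require Import classical_sets fsbigop reals sequences exp trigo.

(** The identities are the roots-of-unity filter applied to the binomial
    expansion of [(x + 1) ^+ m]. Let [w] be a primitive [n]-th root of unity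
    and [rho] nonzero, so that the nodes [rho * w ^+ j] are the [n]-th roots of
    [rho ^+ n]. The average of [x ^+ k / x ^+ r] over the nodes vanishes unless
    [k] and [r] are congruent modulo [n], and equals [(rho ^+ n) ^+ t] when
    [k = n * t + r] (lemma [sum_node_ratio]). Expanding [(x + 1) ^+ m] and
    averaging against [x ^- r] therefore keeps exactly the binomial
    coefficients ['C(m, n * t + r)], weighted by [(rho ^+ n) ^+ t]
    (lemma [sum_binomial_filter]).

    Both formulas are instances with [r = s - 1]. As [omega = mu ^+ 2], the
    nodes [omega ^+ j] and [mu ^ (2 * j - 1)], for [j] from 1 to [n], are
    [rho * omega ^+ (j - 1)] with [rho = omega] and [rho = mu] respectively,
    and the weights are [1 ^+ t] and [(-1) ^+ t] because [omega ^+ n = 1] and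
    [mu ^+ n = -1]. Primitivity of [omega] holds because, for [0 < k < n],
    [mu ^+ k] has imaginary part [sin (k * pi / n) > 0], hence is not a square
    root of 1. *)

Set Implicit Arguments.
Unset Strict Implicit.
Unset Printing Implicit Defensive.

Import Order.TTheory GRing.Theory Num.Theory.

Local Open Scope ring_scope.
Local Open Scope complex_scope.

(** Geometric sum: [z - 1] kills it because [z ^+ n = 1]. *)
Lemma sum_expr_unity_root (F : fieldType) (n : nat) (z : F) : z ^+ n = 1 ->
  \sum_(j < n) z ^+ j = if z == 1 then n%:R else 0.
Proof.
move=> zn1; case: eqP => [->|/eqP z1].
  by under eq_bigr do rewrite expr1n; rewrite sumr_const card_ord.
apply/eqP; have := subrX1 z n; rewrite zn1 subrr => /esym/eqP.
by rewrite mulf_eq0 subr_eq0 (negPf z1).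
Qed.

(** The factor depending on [rho] comes out, leaving a geometric sum of ratio
    [w ^+ k / w ^+ r], which is 1 exactly when [k] and [r] agree modulo [n]. *)
Lemma sum_node_ratio (F : fieldType) (n : nat) (w rho : F) (k r : nat) :
  n.-primitive_root w -> rho != 0 -> (r < n)%N ->
  \sum_(j < n) (rho * w ^+ j) ^+ k / (rho * w ^+ j) ^+ r
    = if (k %% n == r)%N then n%:R * (rho ^+ n) ^+ (k %/ n) else 0.
Proof.
move=> wP rho0 ltrn; have n_gt0 := prim_order_gt0 wP.
have w0 : w != 0 by rewrite (prim_root_eq0 wP) -lt0n.
pose z := w ^+ k / w ^+ r.
have zn1 : z ^+ n = 1.
  rewrite /z exprMn exprVn -!exprM ![(_ * n)%N]mulnC !exprM.
  by rewrite (prim_expr_order wP) !expr1n invr1 mulr1.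
have z1E : (z == 1) = (k %% n == r)%N.
  rewrite /z -(inj_eq (mulIf (expf_neq0 r w0))) mul1r divfK ?expf_neq0 //.
  by rewrite (eq_prim_root_expr wP) (modn_small ltrn).
transitivity (rho ^+ k / rho ^+ r * \sum_(j < n) z ^+ j).
  rewrite mulr_sumr; apply: eq_bigr => j _.
  rewrite /z !exprMn invfM exprVn -!exprM ![(j * _)%N]mulnC.
  by rewrite mulrACA.
rewrite sum_expr_unity_root // z1E; case: eqP => [kr|_]; last by rewrite mulr0.
rewrite {1}(divn_eq k n) kr exprD mulfK ?expf_neq0 // mulrC.
by rewrite [(_ * n)%N]mulnC exprM.
Qed.

(** Quotient and remainder identify the [k <= m] congruent to [r] with the [t]
    such that [n * t + r <= m]; the vanishing hypothesis on [f] lets [t] run up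
    to [m] instead. Passing the quotient to [f] as a separate argument spares
    the right-hand side a division. *)
Lemma sum_residue_class (V : nmodType) (n r m : nat) (f : nat -> nat -> V) :
  (r < n)%N -> (forall t k, (m < k)%N -> f t k = 0) ->
  \sum_(k < m.+1 | (k %% n == r)%N) f (k %/ n)%N k
    = \sum_(t < m.+1) f t (n * t + r)%N.
Proof.
move=> ltrn f0; have n_gt0 : (0 < n)%N by apply: leq_ltn_trans ltrn.
have divE (k t : nat) : (k == n * t + r)%N = (k %% n == r)%N && (t == k %/ n)%N.
  apply/eqP/andP => [->|[/eqP kr /eqP ->]].
    by rewrite mulnC modnMDl divnMDl // modn_small // divn_small // addn0 !eqxx.
  by rewrite mulnC -kr -divn_eq.
transitivity
    (\sum_(k < m.+1) \sum_(t < m.+1 | (k == n * t + r :> nat)%N) f t k).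
  rewrite big_mkcond /=; apply: eq_bigr => k _.
  under eq_bigl do rewrite divE.
  case: eqP => _ /=; last by rewrite big_pred0_eq.
  have lt_km : (k %/ n < m.+1)%N by apply: leq_ltn_trans (leq_div _ _) _.
  by rewrite (big_pred1 (Ordinal lt_km)) // => t; rewrite -val_eqE.
rewrite (exchange_big_dep xpredT) //=; apply: eq_bigr => t _.
case: (ltnP m (n * t + r)) => [lt_m|le_m].
  rewrite f0 // big_pred0 // => k.
  by apply: ltn_eqF; apply: leq_trans lt_m.
rewrite -ltnS in le_m.
by rewrite (big_pred1 (Ordinal le_m)) // => k; rewrite -val_eqE.
Qed.

(** Exchanging the two summations leaves, for each [k], the node sum computed in
    [sum_node_ratio], which selects the residue class of [r]. *)
Lemma sum_binomial_filter (F : fieldType) (n r m : nat) (w rho : F) :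
  n.-primitive_root w -> rho != 0 -> (r < n)%N ->
  \sum_(j < n) (rho * w ^+ j + 1) ^+ m / (rho * w ^+ j) ^+ r
    = n%:R * \sum_(t < m.+1) (rho ^+ n) ^+ t * 'C(m, n * t + r)%:R.
Proof.
move=> wP rho0 ltrn.
under eq_bigr do rewrite addrC exprDn mulr_suml.
rewrite exchange_big /=.
under eq_bigr => k _.
  under eq_bigr do rewrite expr1n mul1r -mulr_natr mulrAC.
  rewrite -mulr_suml (sum_node_ratio _ wP rho0 ltrn).
  rewrite (fun_if (fun x => x * _)) mul0r.
  over.
rewrite -big_mkcond /= mulr_sumr.
rewrite (@sum_residue_class _ n r m
  (fun t k => n%:R * (rho ^+ n) ^+ t * 'C(m, k)%:R)) //.
  by under eq_bigr do rewrite -mulrA.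
by move=> t k mk; rewrite bin_small // mulr0.
Qed.

Lemma fsum_trunc (V : nmodType) (m : nat) (f : nat -> V) :
  (forall t, (m < t)%N -> f t = 0) ->
  \sum_(t \in [set: nat]%classic) f t = \sum_(t < m.+1) f t.
Proof.
move=> f0.
rewrite (fsbigE (index_iota 0 m.+1)) ?iota_uniq //=.
  by rewrite -(big_mkord xpredT); apply: eq_bigl => t; rewrite in_setT.
by move=> t _; rewrite mem_index_iota /= ltnS -ltnNge => /f0.
Qed.

Lemma cexp_imaginary (R : realType) (x : R) :
  cexp (x%:C * 'i%C) = cos x +i* sin x.
Proof. by rewrite /cexp ReiNIm ImiRe /= oppr0 expR0 mul1r. Qed.

Lemma de_moivre (R : realType) (x : R) (k : nat) :
  (cos x +i* sin x) ^+ k = cos (x *+ k) +i* sin (x *+ k).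
Proof.
elim: k => [|k IHk]; first by rewrite !mulr0n cos0 sin0.
rewrite exprS IHk mulrS cosD sinD; simpc.
by rewrite [cos x * sin _ + _]addrC.
Qed.

Lemma cis_pi_div_expn (R : realType) (n : nat) : (0 < n)%N ->
  (cos (pi / n%:R) +i* sin (pi / n%:R)) ^+ n = -1 :> R[i].
Proof.
move=> n_gt0; rewrite de_moivre -[_ *+ n]mulr_natr divfK ?pnatr_eq0 -?lt0n //.
by rewrite cospi sinpi; apply/eqP; rewrite eq_complex /= oppr0 !eqxx.
Qed.

(** If [mu ^+ 2] had order [k < n], then [mu ^+ k] would be 1 or -1, whereas its
    imaginary part [sin (k * pi / n)] is positive. *)
Lemma cis_pi_div_sqr_primitive (R : realType) (n : nat) : (0 < n)%N ->
  n.-primitive_root ((cos (pi / n%:R) +i* sin (pi / n%:R)) ^+ 2 : R[i]).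
Proof.
move=> n_gt0; rewrite /primitive_root_of_unity n_gt0.
apply/forallP => k; rewrite unity_rootE exprAC.
have [->|neq_kn] := eqVneq k.+1 n.
  by rewrite cis_pi_div_expn // sqrrN expr1n eqxx.
have lt_kn : (k.+1 < n)%N by rewrite ltn_neqAle neq_kn ltn_ord.
rewrite eqbF_neg sqrf_eq1 de_moivre; apply/negP.
have n0 : 0 < n%:R :> R by rewrite ltr0n.
have sin_gt0 : 0 < sin (pi / n%:R *+ k.+1) :> R.
  apply: sin_gt0_pi; rewrite pmulrn_lgt0 // divr_gt0 ?pi_gt0 //=.
  by rewrite -mulr_natr mulrAC ltr_pdivrMr // ltr_pM2l ?pi_gt0 // ltr_nat.
by rewrite !eq_complex /= oppr0 (gt_eqF sin_gt0) !andbF.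
Qed.

Theorem theorem1 (R : realType) (n : nat) (hn : (0 < n)%N) :
  let omega : R[i] := cexp (2 * (pi : R)%:C * 'i%C / n%:R) in
  let mu : R[i] := cexp ((pi : R)%:C * 'i%C / n%:R) in
  forall (m s : nat), (1 <= s <= n)%N ->
    \sum_(t \in [set: nat]%classic) ('C(m, n * t + s - 1)%:R : R[i])
      = n%:R^-1 * \sum_(1 <= j < n.+1)
          (omega ^+ j + 1) ^+ m * omega ^ (j%:Z * (1 - s%:Z))
    /\
    \sum_(t \in [set: nat]%classic)
        ((-1) ^+ t * 'C(m, n * t + s - 1)%:R : R[i])
      = n%:R^-1 * \sum_(1 <= j < n.+1)
          (mu ^ (2 * j%:Z - 1) + 1) ^+ m * mu ^ ((2 * j%:Z - 1) * (1 - s%:Z)).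
Proof.
move=> omega mu m [//|r] /= ltrn.
have muE : mu = cos (pi / n%:R) +i* sin (pi / n%:R).
  rewrite -cexp_imaginary; congr cexp.
  by rewrite [X in _ = X * _]rmorphM /= fmorphV rmorph_nat mulrAC.
have omegaE : omega = mu ^+ 2.
  rewrite muE de_moivre -cexp_imaginary; congr cexp.
  rewrite [X in _ = X * _]rmorphMn /= [X in _ = X *+ _ * _]rmorphM /=.
  by rewrite fmorphV rmorph_nat -[X in _ = X * _]mulr_natl mulrA [RHS]mulrAC.
have omegaP : n.-primitive_root omega.
  by rewrite omegaE muE; apply: cis_pi_div_sqr_primitive.
have mun : mu ^+ n = -1 by rewrite muE; apply: cis_pi_div_expn.
have omegan : omega ^+ n = 1 by apply: prim_expr_order.
have omega0 : omega != 0 by rewrite (prim_root_eq0 omegaP) -lt0n.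
have mu0 : mu != 0.
  by apply: contra_neq omega0; rewrite omegaE => ->; rewrite expr0n.
have n0 : n%:R != 0 :> R[i] by rewrite pnatr_eq0 -lt0n.
have idxE t : (n * t + r.+1 - 1 = n * t + r)%N by rewrite addnS subn1.
have lt_bin t : (m < t)%N -> 'C(m, n * t + r) = 0%N.
  move=> lt_mt; apply: bin_small; apply: (leq_trans lt_mt).
  by rewrite (leq_trans (leq_pmull t hn)) ?leq_addr.
have sE : 1 - r.+1%:Z = - r%:Z by rewrite -addn1 PoszD; ring.
split; rewrite big_add1 big_mkord; apply: (mulfI n0); rewrite mulVKf //;
  rewrite (@fsum_trunc _ m) => [|t mt]; rewrite ?idxE ?lt_bin ?mulr0 //.
- rewrite (eq_bigr (fun t : 'I__ => (omega ^+ n) ^+ t * 'C(m, n * t + r)%:R));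
    last by move=> t _; rewrite omegan expr1n mul1r idxE.
  rewrite -(sum_binomial_filter _ omegaP omega0 ltrn); apply: eq_bigr => j _.
  by rewrite sE -exprz_exp -exprnN -exprnP -exprS.
(* the sign is the weight of the filter with [rho = mu] *)
under eq_bigr do rewrite idxE -mun.
rewrite -(sum_binomial_filter _ omegaP mu0 ltrn); apply: eq_bigr => j _.
have -> : 2 * j.+1%:Z - 1 = (2 * j)%N.+1%:Z.
  by rewrite !intS PoszM; ring.
by rewrite sE -exprz_exp -exprnN -exprnP omegaE -(exprM mu 2) -exprS.
Qed.
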